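(* Let $Q_2(x)=(1-|x|)\chi_{[-1,1]}(x)$ be the second order B-spline, i.e. $Q_2=Q_1*Q_1$ with $Q_1=\chi_{[-1/2,1/2]}$. For $g\in L^2(\mathbb{R})$ and $a,b>0$ let $\mathcal{G}(g,a,b)=\{e^{2\pi i b j\cdot}g(\cdot-a l): l,j\in\mathbb{Z}\}$. (i) Let $k,m\in\mathbb{N}$ with $k>m$, put $a_0=\frac{1}{2m+1}$, $b_0=\frac{2k+1}{2}$, and assume $a_0b_0<1$. Then for every $a,b>0$ with $ab=\frac{2k+1}{2(2m+1)}$ and $b\in\left[b_0-a_0\frac{k-m}{2},\, b_0+a_0\frac{k-m}{2}\right]$, the Gabor system $\mathcal{G}(Q_2,a,b)$ is not a frame for $L^2(\mathbb{R})$. (ii) Let $k,m\in\mathbb{N}$ with $k>m$, and let $a=\frac{1}{2m}$, $b=\frac{2k+1}{2}$ with $ab<1$ and $\gcd(4m,2k+1)=1$. Then $\mathcal{G}(Q_2,a,b)$ is not a frame for $L^2(\mathbb{R})$.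
   Context: A family $\{f_j\}$ in $L^2(\mathbb{R})$ is a frame if there exist $0<A\le B$ with $A\|f\|^2\le\sum_j|\langle f,f_j\rangle|^2\le B\|f\|^2$ for all $f\in L^2(\mathbb{R})$. *)

(* Defs.v *)
(* Complex-valued functions R -> C are represented
   as pairs (real part, imaginary part) of real-valued functions. *)
From HB Require Import structures.
From mathcomp Require Import all_boot all_order all_algebra.
From mathcomp Require Import all_classical all_reals all_analysis.
From mathcomp Require Import Rstruct Rstruct_topology.
Set Implicit Arguments. Unset Strict Implicit. Unset Printing Implicit Defensive.
Import Order.TTheory GRing.Theory Num.Theory.
Import numFieldNormedType.Exports.
Local Open Scope classical_set_scope.
Local Open Scope ring_scope.

Section Gabor.
Variable R : realType.
Let mu := @lebesgue_measure R.

(* a complex-valued function on R: (Re f, Im f) *)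
Definition cfun := ((R -> R) * (R -> R))%type.

Definition sqnorm (f : cfun) : \bar R :=
  (\int[mu]_x ((f.1 x) ^+ 2 + (f.2 x) ^+ 2)%:E)%E.

Definition inL2 (f : cfun) : Prop :=
  measurable_fun setT f.1 /\ measurable_fun setT f.2 /\ (sqnorm f < +oo)%E.

(* <f, g> = \int f * conj g ; real and imaginary parts *)
Definition inner_re (f g : cfun) : R :=
  Rintegral mu setT (fun x => f.1 x * g.1 x + f.2 x * g.2 x).
Definition inner_im (f g : cfun) : R :=
  Rintegral mu setT (fun x => f.2 x * g.1 x - f.1 x * g.2 x).

Definition inner_sqabs (f g : cfun) : R := inner_re f g ^+ 2 + inner_im f g ^+ 2.

Definition is_frame (I : choiceType) (F : I -> cfun) : Prop :=
  exists A B : R, 0 < A /\ A <= B /\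
    forall f : cfun, inL2 f ->
      ((A%:E * sqnorm f <= \esum_(j in [set: I]) (inner_sqabs f (F j))%:E) /\
       (\esum_(j in [set: I]) (inner_sqabs f (F j))%:E <= B%:E * sqnorm f))%E.

(* Gabor system G(g,a,b) = { x |-> e^{2 pi i b j x} g(x - a l) : l, j in Z },
   indexed by (l, j) *)
Definition gabor (g : cfun) (a b : R) (lj : int * int) : cfun :=
  let l := lj.1 in let j := lj.2 in
  (fun x => cos (2 * pi * b * j%:~R * x) * g.1 (x - a * l%:~R)
            - sin (2 * pi * b * j%:~R * x) * g.2 (x - a * l%:~R),
   fun x => sin (2 * pi * b * j%:~R * x) * g.1 (x - a * l%:~R)
            + cos (2 * pi * b * j%:~R * x) * g.2 (x - a * l%:~R)).

Definition Q2 : cfun :=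
  (fun x => if `|x| <= 1 then 1 - `|x| else 0, fun _ => 0).

End Gabor.

(* Main.v *)
(* The matrices [(Q_2(n/b - a l))_(l,n)] inherit the lower frame bound: test the
   frame inequality on [f = sum_n c_n 1_[n/b, n/b + d]], apply Bessel's inequality
   to each block of exponentials and let [d] tend to [0]. It therefore suffices to
   find a nonzero periodic sequence [c] with [sum_n c_n Q_2(n/b - a l) = 0] for all
   [l]; its truncations contradict the lower bound, since only boundary terms
   survive.

   Let [p = 2k+1] and [P = p/b]. In both cases [P/2 = M a] with an integer
   [M <= 2m+1]. Take [c] odd and [p]-periodic. The [P]-periodization of [Q_2]
   agrees, away from a window of half-width [|P/2 - 1|] around [P/2], with a tent of
   half-width [P/2], and such a tent satisfies [T(y) + T(y + P/2) = const]. If [c]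
   is supported on the indices [n] whose shifts [n/b - a l] avoid the windows, then
   [l |-> sum_n c_n Q_2(n/b - a l)] is odd and changes sign under
   [l -> l + M], so that only the [m] equations for [l = 1..m] remain. When [P = 2]
   the windows are empty and there are [k > m] admissible indices; in case (i) the
   bound on [b] excludes at most [k - m - 1] of the indices [1..k]. *)
Require Import Defs.
From HB Require Import structures.
From mathcomp Require Import all_boot all_order all_algebra.
From mathcomp Require Import all_classical all_reals all_analysis.
From mathcomp Require Import Rstruct Rstruct_topology.
From mathcomp Require Import measurable_realfun.
From mathcomp Require Import zify ring lra.
Set Implicit Arguments.
Unset Strict Implicit.
Unset Printing Implicit Defensive.
Import Order.TTheory GRing.Theory Num.Theory.
Import numFieldNormedType.Exports.
Local Open Scope ring_scope.

(** * Linear algebra and counting *)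

(** The rows indexed by [G] form a matrix of rank at most [m < #|G|], so it has a nonzero left
    kernel vector; [v] is its extension by zero. *)
Lemma exists_supported_kernel (F : fieldType) (k m : nat) (G : {set 'I_k})
    (E : 'I_k -> 'I_m -> F) : (m < #|G|)%N ->
  exists v : 'I_k -> F, [/\ exists r, v r != 0, forall r, r \notin G -> v r = 0
    & forall l, \sum_r v r * E r l = 0].
Proof.
move=> mG.
pose A : 'M[F]_(#|G|, m) := \matrix_(i, l) E (enum_val i) l.
have : kermx A != 0.
  rewrite -mxrank_eq0 mxrank_ker -lt0n subn_gt0.
  exact: leq_ltn_trans (rank_leq_col A) mG.
case/rowV0Pn => w /sub_kermxP wA w0.
have [i0 wi0] : exists i, w 0 i != 0.
  by case/matrix0Pn: w0 => i [j]; rewrite ord1; exists j.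
pose v r := \sum_i (if enum_val i == r then w 0 i else 0).
have vE i : v (enum_val i) = w 0 i.
  rewrite /v (bigD1 i)//= eqxx big1 ?addr0// => j ji.
  by rewrite (inj_eq enum_val_inj) (negbTE ji).
exists v; split.
- by exists (enum_val i0); rewrite vE.
- move=> r rG; rewrite /v big1// => i _; case: eqP => // ir.
  by rewrite -ir enum_valP in rG.
- move=> l; rewrite (bigID (fun r => r \in G)) /= [X in _ + X]big1 ?addr0; last first.
    move=> r rG; rewrite /v big1 ?mul0r// => i _; case: eqP => // ir.
    by rewrite -ir enum_valP in rG.
  have /matrixP/(_ 0 l) := wA; rewrite !mxE; apply: etrans.
  rewrite (big_enum_val (fun r => v r * E r l))/=.
  by apply: eq_bigr => i _; rewrite vE !mxE.
Qed.

(* With [s = k - m], an index [n = r.+1] in the set has [|(2k+1) l - 4 s n| < s] for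
   some [l] with [0 < l < 2 s]; the multiple [(2k+1) l] determines [n], and by parity
   [l] and [2 s - l] cannot both occur, so [n |-> min l (2 s - l)] is injective
   into [1..s-1]. *)
Lemma card_near_multiple (k m : nat) : (m < k)%N ->
  (#|[set r : 'I_k | `[< exists l : int,
      (`|(2 * (2 * m + 1) * r.+1)%:Z - (2 * k + 1)%:Z * l| < (k - m)%:Z)%R >] ]| < k - m)%N.
Proof.
move=> mk; set B := [set _ | _].
have s0 : (0 < k - m)%N by lia.
have /choice[f fP] : forall r : 'I_k, exists l : int, r \in B ->
    `|(2 * k + 1)%:Z * l - (4 * (k - m) * r.+1)%:Z| < (k - m)%:Z.
  move=> r; have [|_] := boolP (r \in B); last by exists 0.
  (* With [n = r.+1], the identity [2 (2m+1) n - (2k+1) l = (2k+1) (2n - l) - 4 (k-m) n] dictates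
     the witness. *)
  rewrite inE => /asboolP[l ll]; exists (2 * r.+1%:Z - l) => _.
  suff -> : (2 * k + 1)%:Z * (2 * r.+1%:Z - l) - (4 * (k - m) * r.+1)%:Z =
     (2 * (2 * m + 1) * r.+1)%:Z - (2 * k + 1)%:Z * l by [].
  nia.
(* Since [1 <= n <= k], the product [(2k+1) (f r)] lies strictly between [0] and
   [4 s k + 2 s = 2 s (2k+1)]. *)
have fpos r : r \in B -> 0 < f r < 2 * (k - m)%:Z.
  move=> /fP rP; have := ltn_ord r; move: rP.
  move: (nat_of_ord r) (f r) => n l; clear -s0 mk.
  move: s0; move: (k - m)%N => s s0 H nk. nia.
pose g r : nat := if f r < (k - m)%:Z then `|f r|%N else `|(2 * (k - m)%:Z - f r)%R|%N.
(* At [l = s] the difference would be [s] times the odd number [2k + 1 - 4n], hence at least [s] in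
   absolute value. *)
have sneq r : r \in B -> f r != (k - m)%:Z.
  move=> /fP rP; apply/eqP => fr; move: rP; rewrite fr.
  move: s0 (nat_of_ord r); move: (k - m)%N => s s0 n.
  have -> : (2 * k + 1)%:Z * s - (4 * s * n.+1)%:Z = (2 * k%:Z + 1 - 4 * n.+1%:Z) * s%:Z.
    by rewrite PoszD !PoszM; ring.
  have odd_ne0 : 1 <= `|2 * k%:Z + 1 - 4 * n.+1%:Z| by clear; lia.
  rewrite normrM; clear -s0 odd_ne0; nia.
have gP r : r \in B -> (0 < g r < k - m)%N.
  by move=> rB; have := fpos _ rB; have := sneq _ rB; rewrite /g; case: ifP; lia.
have ginj : {in B &, injective g}.
  move=> r1 r2 r1B r2B g12.
  have H : f r1 = f r2 \/ f r1 + f r2 = 2 * (k - m)%:Z.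
    move: g12 (fpos _ r1B) (fpos _ r2B); rewrite /g; case: ifP; case: ifP; lia.
  move: (fP _ r1B) (fP _ r2B) => A1 A2; apply/val_inj => /=.
  move: (nat_of_ord r1) (nat_of_ord r2) A1 A2 H => n1 n2.
  move: (f r1) (f r2) => l1 l2; clear -s0.
  move: s0; move: (k - m)%N => s s0 A1 A2 [H|H].
    subst l2; move: A1 A2; move: ((2 * k + 1)%:Z * l1) => z A1 A2; nia.
  (* Here the two differences add up to [2 s] times an odd number, although each is smaller than [s]
     in absolute value. *)
  have {H}l2E : l2 = 2 * s%:Z - l1 by lia.
  subst l2.
  have E : (2 * k + 1)%:Z * l1 - (4 * s * n1.+1)%:Z -
      ((4 * s * n2.+1)%:Z - (2 * k + 1)%:Z * (2 * s%:Z - l1)) =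
      (2 * k%:Z + 1 - 2 * (n1.+1%:Z + n2.+1%:Z)) * (2 * s%:Z).
    by rewrite PoszD !PoszM; ring.
  have odd_ne0 : 1 <= `|2 * k%:Z + 1 - 2 * (n1.+1%:Z + n2.+1%:Z)| by clear; lia.
  have := congr1 (fun z => `|z|) E; rewrite normrM {E}; nia.
suff : (#|B| <= #|[set x : 'I_(k - m) | (0 < x)%N]|)%N.
  move=> /leq_ltn_trans; apply.
  rewrite -[X in (_ < X)%N]card_ord -cardsT; apply: proper_card.
  apply/properP; split; first exact/fintype.subsetP.
  by exists (Ordinal s0); rewrite ?inE.
pose h r : 'I_(k - m) := insubd (Ordinal s0) (g r).
have hE r : r \in B -> h r = g r :> nat.
  by move=> /gP/andP[_ gr]; rewrite /h val_insubd gr.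
rewrite -(card_in_imset (f := h) (D := B)); last first.
  by move=> x y xB yB /(congr1 val)/=; rewrite !hE//; exact: ginj.
apply/subset_leq_card/fintype.subsetP => _ /imsetP[r rB ->].
by rewrite inE hE//; case/andP: (gP _ rB).
Qed.

(** * Periodized tents *)

Section Tent.
Context {R : realFieldType}.
Implicit Types (x y P a : R).

Definition tent x : R := if `|x| <= 1 then 1 - `|x| else 0.

Lemma tentN x : tent (- x) = tent x.
Proof. by rewrite /tent normrN. Qed.

Lemma tentE x : tent x = Num.max 0 (1 - `|x|).
Proof.
rewrite /tent; case: ifPn => [x1|]; first by rewrite max_r ?subr_ge0.
by rewrite -ltNge => x1; rewrite max_l// subr_le0 ltW.
Qed.

Lemma tent_eq0 x : 1 <= `|x| -> tent x = 0.
Proof. by move=> x1; rewrite tentE max_l// subr_le0. Qed.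

Lemma tent_pos x : 0 <= x <= 1 -> tent x = 1 - x.
Proof. by case/andP => x0 x1; rewrite tentE ger0_norm// max_r ?subr_ge0. Qed.

Lemma tent_neg x : -1 <= x <= 0 -> tent x = 1 + x.
Proof. by move=> x01; rewrite -tentN tent_pos ?opprK//; lra. Qed.

Lemma tent_ge0 x : 0 <= tent x. Proof. by rewrite tentE le_max lexx. Qed.

Lemma tent_le1 x : tent x <= 1.
Proof. by rewrite tentE ge_max ler01 gerBl normr_ge0. Qed.

Lemma tent_lipschitz x y : `|tent x - tent y| <= `|x - y|.
Proof.
rewrite !tentE /Num.max; have := lerB_dist x y; have := lerB_dist y x.
rewrite (distrC y) => h1 h2.
case: ifPn; case: ifPn; rewrite -?leNgt => h3 h4; rewrite ler_norml; lra.
Qed.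

(* On [`|x| <= 2 * P - 1], for [1 < P], this is the [P]-periodization of the tent. *)
Definition tent3 P x : R := tent (x - P) + tent x + tent (x + P).

(** Outside the windows only one translate can contribute at each of the two points. For [y >= 0]
    the values are [1 - y] and [1 + y - P / 2], whose sum is free of [y]; the case [y < 0] is the
    mirror image. *)
Lemma tent3_half_period P y : 1 < P -> `|y| <= P / 2 ->
  `|P / 2 - 1| <= `|y| -> `|P / 2 - 1| <= `|y - P / 2| ->
  `|P / 2 - 1| <= `|y + P / 2| -> tent3 P y + tent3 P (y + P / 2) = 2 - P / 2.
Proof.
move=> P1; rewrite ler_norml /tent3 => /andP[yP1 yP2].
have [d [-> dP]] : exists d, `|P / 2 - 1| = d /\
    (P <= 2 /\ d = 1 - P / 2 \/ 2 <= P /\ d = P / 2 - 1).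
  have [P2|P2] := leP P 2.
    by exists (1 - P / 2); split; [rewrite distrC ger0_norm; lra|left].
  by exists (P / 2 - 1); split; [rewrite ger0_norm; lra|right; split; lra].
move=> h1 h2 h3.
have [y0|y0] := leP 0 y.
  have {h1 h2 h3} [h1 h2] : d <= y /\ y <= P / 2 - d.
    split; first by rewrite ger0_norm in h1.
    by move: h2; rewrite ler0_norm; lra.
  rewrite (@tent_eq0 (y - P)) ?(@tent_eq0 (y + P)) ?(@tent_pos y) ?(@tent_eq0 (y + P / 2))
    ?(@tent_eq0 (y + P / 2 + P)) ?(@tent_neg (y + P / 2 - P)) ?ler_normr;
    by case: dP => -[]; lra.
have {h1 h2 h3} [h1 h2] : d <= - y /\ - y <= P / 2 - d.
  split; first by rewrite ltr0_norm in h1.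
  by move: h3; rewrite ger0_norm; lra.
rewrite (@tent_eq0 (y - P)) ?(@tent_eq0 (y + P)) ?(@tent_neg y) ?(@tent_eq0 (y + P / 2 - P))
  ?(@tent_eq0 (y + P / 2 + P)) ?(@tent_pos (y + P / 2)) ?ler_normr;
  by case: dP => -[]; lra.
Qed.

Lemma tent_far P x y : 1 < P -> `|x| < P / 2 -> 3 * (P / 2) <= `|y| -> tent (x - y) = 0.
Proof.
move=> P1 xP yP; apply: tent_eq0; have := lerB_dist y x; rewrite (distrC y); lra.
Qed.

End Tent.

Lemma ler_sum_uniq_support (R : numDomainType) (T : eqType) (h : T -> R) (s W : seq T) :
  uniq s -> uniq W -> (forall x, 0 <= h x) ->
  (forall x, x \in s -> x \notin W -> h x = 0) ->
  \sum_(x <- s) h x <= \sum_(x <- W) h x.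
Proof.
move=> us uW h0 sW; rewrite (bigID (mem W))/= [X in _ + X]big1_seq ?addr0; last first.
  by move=> x /andP[xW xs]; exact: sW.
rewrite -big_filter (perm_big (seq.filter (mem s) W)); last first.
  by apply: uniq_perm; rewrite ?filter_uniq// => x; rewrite !mem_filter/= andbC.
by rewrite big_filter [leRHS](bigID (mem s))/= lerDl sumr_ge0.
Qed.

(** * Odd periodic coefficients with bounded column sums *)

Section Kernel.
Variables (R : realFieldType) (k m M : nat) (a P : R) (x : 'I_k -> R) (G : {set 'I_k}).
Hypotheses (P1 : 1 < P) (PE : P / 2 = M%:R * a) (a0 : 0 < a) (Mm : (M <= 2 * m + 1)%N).
Hypothesis (xP : forall r, 0 < x r < P / 2).
Hypothesis (good : forall r, r \in G -> forall l : int, `|P / 2 - 1| <= `|x r - a * l%:~R|).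
Hypothesis (mG : (m < #|G|)%N).

(** Periodized contribution of a coefficient [1] at [x r] and [-1] at [- x r]; as the tent is even,
    the second term is the translate to [- x r]. *)
Let e r y : R := tent3 P (x r - y) - tent3 P (x r + y).

Let e0 r : e r 0 = 0. Proof. by rewrite /e subr0 addr0 subrr. Qed.

Let eN r y : e r (- y) = - e r y. Proof. by rewrite /e opprK opprB. Qed.

(** The half-period identity at [x r - a l] and at [x r + a l - P / 2] has the same constant on the
    right; subtracting the two exchanges [a l] and [P / 2 - a l]. *)
Let e_reflect r (l : nat) : r \in G -> (l <= M)%N ->
  e r (a * (M - l)%:R) = e r (a * l%:R).
Proof.
move=> rG lM; rewrite natrB//.
have hl0 : 0 <= a * l%:R by rewrite mulr_ge0// ltW.
have hlM : a * l%:R <= P / 2 by rewrite PE mulrC ler_wpM2r ?ler_nat// ltW.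
have yE : a * (M%:R - l%:R) = P / 2 - a * l%:R by rewrite PE; ring.
have := xP r => /andP[x0 xP2].
(* Because [P / 2 = M a], every point that must avoid a window has the form [x r - a i] with [i] an
   integer. *)
have glM (i : int) z : z = x r - a * i%:~R -> `|P / 2 - 1| <= `|z|.
  by move=> ->; exact: good.
have A : tent3 P (x r - a * l%:R) + tent3 P (x r - a * l%:R + P / 2) = 2 - P / 2.
  apply: tent3_half_period => //.
  - by rewrite ler_norml; lra.
  - by apply: (glM l).
  - by apply: (glM (l%:Z + M%:Z)); rewrite PE intrD; ring.
  - by apply: (glM (l%:Z - M%:Z)); rewrite PE intrB; ring.
have B : tent3 P (x r + a * l%:R - P / 2) +
    tent3 P (x r + a * l%:R - P / 2 + P / 2) = 2 - P / 2.
  apply: tent3_half_period => //.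
  - by rewrite ler_norml; lra.
  - by apply: (glM (M%:Z - l%:Z)); rewrite PE intrB; ring.
  - by apply: (glM (2 * M%:Z - l%:Z)); rewrite PE intrB intrM; ring.
  - by apply: (glM (- l%:Z)); rewrite PE intrN; ring.
rewrite /e yE.
have -> : x r - (P / 2 - a * l%:R) = x r + a * l%:R - P / 2 by ring.
have -> : x r + (P / 2 - a * l%:R) = x r - a * l%:R + P / 2 by ring.
move: B; have -> : x r + a * l%:R - P / 2 + P / 2 = x r + a * l%:R by ring.
lra.
Qed.

Let u (v : 'I_k -> R) (l : int) : R :=
  \sum_r v r * (tent (x r - a * l%:~R) - tent (- x r - a * l%:~R)).

Let u_eq0 v (l : int) : (3 * M)%:Z <= `|l| -> u v l = 0.
Proof.
move=> lM; rewrite /u big1// => r _; have /andP[x0 xP2] := xP r.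
have : 3 * (P / 2) <= `|a * l%:~R|.
  rewrite normrM gtr0_norm// -intr_norm PE [X in _ <= X]mulrC mulrA ler_wpM2r ?(ltW a0)//.
  by rewrite (_ : 3 * M%:R = (3 * M)%:Z%:~R) ?ler_int// PoszM intrM.
by move=> H; rewrite !(tent_far P1) ?subrr ?mulr0// ?normrN gtr0_norm.
Qed.

(** As [2 M a = P], shifting [l] by [2 M] shifts [a l] by [P], so the three terms combine into
    [tent3] and give [sum_r v r * e r (a l)]. Only the equations at [1..m] are imposed on [v];
    oddness and reflection supply the others. *)
Let exists_u_periodization : exists v : 'I_k -> R, (exists r, v r != 0) /\
  forall l : int, - M%:Z <= l -> l <= M%:Z ->
    u v (l - (2 * M)%:Z) + u v l + u v (l + (2 * M)%:Z) = 0.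
Proof.
have [v [v0 vG vE]] :=
  exists_supported_kernel (fun r (i : 'I_m) => e r (a * i.+1%:R)) mG.
exists v; split=> // l.
pose ev y := \sum_r v r * e r y.
have evN y : ev (- y) = - ev y.
  by rewrite /ev -sumrN; apply: eq_bigr => r _; rewrite eN mulrN.
have ev_small (i : nat) : (i <= m)%N -> ev (a * i%:R) = 0.
  case: i => [|i] im; last by have := vE (Ordinal im).
  by rewrite /ev big1// => r _; rewrite mulr0 e0 mulr0.
have ev_nat (i : nat) : (i <= M)%N -> ev (a * i%:R) = 0.
  move=> iM; have [/ev_small//|mi] := leqP i m.
  (* For [m < i], the bound [M <= 2 m + 1] gives [M - i <= m], so reflection leads back to an
     imposed equation. *)
  rewrite -(@ev_small (M - i)%N); last by lia.
  apply: eq_bigr => r _; have [rG|/vG ->] := boolP (r \in G); last by rewrite !mul0r.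
  by rewrite e_reflect.
have -> : u v (l - (2 * M)%:Z) + u v l + u v (l + (2 * M)%:Z) = ev (a * l%:~R).
  rewrite /u /ev -!big_split; apply: eq_bigr => r _ /=.
  have E (z : int) : a * (l + z * (2 * M)%:Z)%:~R = a * l%:~R + z%:~R * P.
    rewrite intrD intrM.
    have -> : P = 2 * (M%:R * a) by rewrite -PE; field.
    by rewrite -[(2 * M)%:Z%:~R]/((2 * M)%:R) natrM; ring.
  have := E 1; have := E (-1); rewrite mulN1r !mul1r => -> ->.
  rewrite -mulrDr -mulrDr; congr (_ * _).
  rewrite /e /tent3.
  rewrite -(tentN (- x r - _)) -(tentN (- x r - a * l%:~R)) -(tentN (- x r - (_ + P))).
  rewrite mulN1r.
  have -> : x r - (a * l%:~R - P) = x r - a * l%:~R + P by ring.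
  have -> : x r - (a * l%:~R + P) = x r - a * l%:~R - P by ring.
  have -> : - (- x r - (a * l%:~R - P)) = x r + a * l%:~R - P by ring.
  have -> : - (- x r - (a * l%:~R + P)) = x r + a * l%:~R + P by ring.
  have -> : - (- x r - a * l%:~R) = x r + a * l%:~R by ring.
  ring.
case: (ger0P l) => [l0 _ lM|l0 lM _].
  by case: l l0 lM => // l _ lM; rewrite ev_nat.
have {l0 lM} [i iM ->] : exists2 i : nat, (i <= M)%N & l = - i%:Z.
  by exists `|l|%N; lia.
by rewrite intrN mulrN evN ev_nat ?oppr0.
Qed.

(** The sum over [N] consecutive periods telescopes to two boundary terms, so [C] depends neither on
    [N] nor on [s]. *)
Lemma exists_bounded_partial_sums : exists v : 'I_k -> R, (exists r, v r != 0) /\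
  exists C, forall (N : nat) (s : seq int), uniq s ->
  \sum_(l <- s) (\sum_(j < N) \sum_r v r *
    (tent (j%:R * P + x r - a * l%:~R) - tent (j%:R * P - x r - a * l%:~R))) ^+ 2 <= C.
Proof.
have [v [v0 uP]] := exists_u_periodization; exists v; split=> //.
pose q := (2 * M)%:Z.
(* [h] has finite support and [h l - h (l - q) = u v l], so the inner sums telescope. *)
pose h l := if l < M%:Z then u v l + u v (l - q) else 0.
(* In effect [h l] sums [u v] over [l, l - q, l - 2q, ...]. For [l < M] the terms from [l - 2q] on
   vanish; for [M <= l < 3M] the periodized equation at [l - q] makes the sum zero; from [3M] on,
   [u v l] itself is zero. *)
have hB l : h l - h (l - q) = u v l.
  rewrite /h; have [lM|Ml] := ltP l M%:Z.
    have -> : l - q < M by rewrite /q; lia.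
    by rewrite (@u_eq0 v (l - q - q)) /q; [ring|lia].
  case: ifPn => lq; last by rewrite subrr u_eq0// /q; move: lq; rewrite /q; lia.
  have H : u v (l - q - q) + u v (l - q) + u v (l - q + q) = 0.
    by apply: uP; move: Ml lq; rewrite /q; lia.
  by move: H; rewrite subrK; lra.
(* The integers of [[-3M, M)], which contain the support of [h]. *)
pose W : seq int := [seq i%:Z - (3 * M)%:Z | i <- iota 0 (4 * M)].
have hW l : l \notin W -> h l = 0.
  rewrite /h; case: ifPn => // lM lW.
  suff lM3 : l <= - (3 * M)%:Z by rewrite !u_eq0 ?addr0 /q//; lia.
  rewrite leNgt; apply: contra lW => lM3; apply/mapP.
  by exists `|(l + (3 * M)%:Z)%R|%N; rewrite ?mem_iota; lia.
have uW : uniq W by rewrite map_inj_uniq ?iota_uniq// => i j; lia.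
have hsum (s : seq int) : uniq s -> \sum_(l <- s) h l ^+ 2 <= \sum_(l <- W) h l ^+ 2.
  move=> us; apply: ler_sum_uniq_support => // [l|l _ /hW ->].
    exact: sqr_ge0.
  by rewrite expr0n.
exists (4 * \sum_(l <- W) h l ^+ 2) => N s us.
have SE (l : int) : \sum_(j < N) \sum_r v r *
    (tent (j%:R * P + x r - a * l%:~R) - tent (j%:R * P - x r - a * l%:~R)) =
    h l - h (l - N%:Z * q).
  transitivity (\sum_(j < N) u v (l - j%:Z * q)).
    apply: eq_bigr => j _; apply: eq_bigr => r _.
    have E : a * (l - j%:Z * q)%:~R = a * l%:~R - j%:R * P.
      have -> : P = 2 * (M%:R * a) by rewrite -PE; field.
      by rewrite intrB intrM /q -[(2 * M)%:Z%:~R]/((2 * M)%:R) natrM; ring.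
    by congr (_ * (tent _ - tent _)); rewrite E; ring.
  elim: N => [|N IH]; first by rewrite big_ord0 mul0r subr0 subrr.
  rewrite big_ord_recr/= IH -hB.
  have -> : l - N.+1%:Z * q = l - N%:Z * q - q by rewrite -addn1 PoszD; ring.
  ring.
(* Both [h] and its translate have squared sum at most that over [W], whence the factor
   [4 = 2 + 2]. *)
apply: (@le_trans _ _ (\sum_(l <- s) (2 * h l ^+ 2 + 2 * h (l - N%:Z * q) ^+ 2))).
  apply: ler_sum => l _; rewrite SE.
  have := sqr_ge0 (h l + h (l - N%:Z * q)); nra.
rewrite big_split/= -!mulr_sumr.
have -> : \sum_(l <- s) h (l - N%:Z * q) ^+ 2 =
    \sum_(l <- [seq l - N%:Z * q | l <- s]) h l ^+ 2 by rewrite big_map.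
have us' : uniq [seq l - N%:Z * q | l <- s] by rewrite map_inj_uniq//; exact: addIr.
have := hsum _ us; have := hsum _ us'; lra.
Qed.

End Kernel.

Local Open Scope classical_set_scope.
Local Open Scope ring_scope.

(** * Bessel's inequality for exponentials *)

Section Integral.
Context {R : realType}.
Notation mu := (@lebesgue_measure R).
Implicit Types (f g : R -> R) (x y : R).

Lemma continuous_sum (I : Type) (s : seq I) (F : I -> R -> R) :
  (forall i, continuous (F i)) -> continuous (fun x => \sum_(i <- s) F i x).
Proof.
move=> cF x; elim: s => [|i s IH].
  by under eq_fun do rewrite big_nil; exact: cvg_cst.
by under eq_fun do rewrite big_cons; apply: cvgD => //; exact: cF.
Qed.

Lemma continuous_mul (f g : R -> R) : continuous f -> continuous g ->
  continuous (fun x => f x * g x).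
Proof. by move=> cf cg x; apply: cvgM; [exact: cf|exact: cg]. Qed.

Lemma continuous_integrable_itv f x y :
  continuous f -> mu.-integrable `[x, y] (EFin \o f).
Proof.
move=> cf; apply: continuous_compact_integrable; first exact: segment_compact.
exact: continuous_subspaceT.
Qed.

Lemma Rintegral_sum d (T : measurableType d) (nu : {measure set T -> \bar R})
    (D : set T) (I : Type) (s : seq I) (F : I -> T -> R) : measurable D ->
  (forall i, nu.-integrable D (EFin \o F i)) ->
  \int[nu]_(z in D) (\sum_(i <- s) F i z) = \sum_(i <- s) \int[nu]_(z in D) F i z.
Proof.
move=> mD iF; elim: s => [|i s IH].
  by under eq_Rintegral do rewrite big_nil; rewrite Rintegral_cst// mul0r big_nil.
under eq_Rintegral do rewrite big_cons.
rewrite RintegralD// ?IH ?big_cons//.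
have -> : EFin \o (fun z => \sum_(i <- s) F i z) =
          (fun z => (\sum_(i <- s) (EFin \o F i) z)%E).
  by apply/funext => z /=; rewrite sumEFin.
exact: integrable_sum.
Qed.

Lemma Rintegral_translate f y d : continuous f -> 0 <= d ->
  \int[mu]_(t in `[y, y + d]) f t = \int[mu]_(t in `[0, d]) f (t + y).
Proof.
move=> cf d0; rewrite /Rintegral; congr fine.
have dF : derive1 (fun t => t + y : R) = cst 1.
  by apply/funext => t; rewrite derive1E derive_val addr0.
have cF : continuous (fun t => t + y : R).
  by move=> t; apply: cvgD; [exact: cvg_id|exact: cvg_cst].
have := @integration_by_substitution_increasing R (fun t => t + y) f 0 d d0.
rewrite add0r (addrC d) => ->.
- by apply: eq_integral => t _; rewrite dF /= mulr1.
- by move=> s t _ _; rewrite ltrD2r.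
- by rewrite dF => t _; exact: cvg_cst.
- by rewrite dF; exact: is_cvg_cst.
- by rewrite dF; exact: is_cvg_cst.
- split=> [t _||].
  + exact: ex_derive.
  + by apply: cvg_at_right_filter; exact: cF.
  + by apply: cvg_at_left_filter; exact: cF.
- exact: continuous_subspaceT.
Qed.

End Integral.

Section Bessel.
Context {R : realType}.
Notation mu := (@lebesgue_measure R).
Variable b : R.
Hypothesis b0 : 0 < b.

(** Real part of the modulation of frequency [b j], of which [sinj] is the imaginary part; both have
    period [b^-1]. *)
Definition cosj (j : int) (t : R) := cos (2 * pi * b * j%:~R * t).
Definition sinj (j : int) (t : R) := sin (2 * pi * b * j%:~R * t).

Lemma continuous_cosj j : continuous (cosj j).
Proof.
move=> t; apply: (@continuous_comp _ _ _ ( *%R (2 * pi * b * j%:~R)) cos).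
  exact: mulrl_continuous.
exact: continuous_cos.
Qed.

Lemma continuous_sinj j : continuous (sinj j).
Proof.
move=> t; apply: (@continuous_comp _ _ _ ( *%R (2 * pi * b * j%:~R)) sin).
  exact: mulrl_continuous.
exact: continuous_sin.
Qed.

Lemma cosjB i j t : cosj (i - j) t = cosj i t * cosj j t + sinj i t * sinj j t.
Proof. by rewrite -cosB /cosj intrB; congr cos; ring. Qed.

Lemma sinjB i j t : sinj (i - j) t = sinj i t * cosj j t - cosj i t * sinj j t.
Proof. by rewrite -sinB /sinj intrB; congr sin; ring. Qed.

Lemma cos_sin_2pi_nat (n : nat) (x : R) :
  cos (x + 2 * pi * n%:R) = cos x /\ sin (x + 2 * pi * n%:R) = sin x.
Proof.
rewrite (_ : 2 * pi * n%:R = (pi *+ 2) *+ n); last by rewrite -[RHS]mulr_natr -[pi *+ 2]mulr_natl.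
by split; [apply: periodicn; exact: cosD2pi|apply: periodicn; exact: sinD2pi].
Qed.

Lemma cos_sin_2pi_int (j : int) (x : R) :
  cos (x + 2 * pi * j%:~R) = cos x /\ sin (x + 2 * pi * j%:~R) = sin x.
Proof.
case: (intP j) => [|n|n]; rewrite ?mulr0 ?addr0//; first exact: cos_sin_2pi_nat.
have := cos_sin_2pi_nat n.+1 (x + 2 * pi * (- n.+1%:Z)%:~R).
by rewrite intrN mulrN subrK => -[<- <-].
Qed.

Lemma cosj_translate j (n : int) (x : R) : cosj j (x + n%:~R / b) = cosj j x.
Proof.
rewrite /cosj mulrDr.
have -> : 2 * pi * b * j%:~R * (n%:~R / b) = 2 * pi * (j * n)%:~R :> R.
  by rewrite intrM; field; rewrite gt_eqF.
by have [] := cos_sin_2pi_int (j * n) (2 * pi * b * j%:~R * x).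
Qed.

Lemma sinj_translate j (n : int) (x : R) : sinj j (x + n%:~R / b) = sinj j x.
Proof.
rewrite /sinj mulrDr.
have -> : 2 * pi * b * j%:~R * (n%:~R / b) = 2 * pi * (j * n)%:~R :> R.
  by rewrite intrM; field; rewrite gt_eqF.
by have [] := cos_sin_2pi_int (j * n) (2 * pi * b * j%:~R * x).
Qed.

Let w_neq0 (j : int) : j != 0 -> 2 * pi * b * j%:~R != 0 :> R.
Proof.
move=> j0; rewrite mulf_eq0 intr_eq0 (negbTE j0) orbF gt_eqF//.
by rewrite !mulr_gt0 ?pi_gt0.
Qed.

(** Through [cosjB] and [sinjB], this and [Rintegral_sinj] give the orthogonality of the
    exponentials over one period. *)
Lemma Rintegral_cosj j : \int[mu]_(t in `[0, b^-1]) cosj j t = b^-1 *+ (j == 0).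
Proof.
have [->|j0] := eqVneq j 0.
  under eq_Rintegral do rewrite /cosj mulr0 mul0r cos0.
  by rewrite Rintegral_cst//= lebesgue_measure_itv/= lte_fin invr_gt0 b0 /= oppr0 addr0 mul1r mulr1n.
pose w : R := 2 * pi * b * j%:~R; pose F t : R := w^-1 * sinj j t.
have w0 : w != 0 := w_neq0 j0.
have dF (t : R) : is_derive t 1 F (cosj j t).
  rewrite /F /sinj -/w; apply: is_derive_eq.
  by rewrite /cosj -/w /GRing.scale/= !(mulr0, addr0, mulr1); field.
rewrite /Rintegral (@continuous_FTC2 _ _ F) ?invr_gt0//.
- by rewrite -EFinB /F -(sinj_translate j 1 0) add0r div1r subrr.
- exact/continuous_subspaceT/continuous_cosj.
- have cF : continuous F by move=> t; exact/differentiable_continuous/derivable1_diffP.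
  split=> [t _||]; first by [].
  + by apply: cvg_at_right_filter; exact: cF.
  + by apply: cvg_at_left_filter; exact: cF.
- by move=> t _; rewrite derive1E derive_val.
Qed.

Lemma Rintegral_sinj j : \int[mu]_(t in `[0, b^-1]) sinj j t = 0.
Proof.
have [->|j0] := eqVneq j 0.
  under eq_Rintegral do rewrite /sinj mulr0 mul0r sin0.
  by rewrite Rintegral_cst// mul0r.
pose w : R := 2 * pi * b * j%:~R; pose F t : R := - w^-1 * cosj j t.
have w0 : w != 0 := w_neq0 j0.
have dF (t : R) : is_derive t 1 F (sinj j t).
  rewrite /F /cosj -/w; apply: is_derive_eq.
  by rewrite /sinj -/w /GRing.scale/= !(mulr0, addr0, mulr1); field.
rewrite /Rintegral (@continuous_FTC2 _ _ F) ?invr_gt0//.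
- by rewrite -EFinB /F -(cosj_translate j 1 0) add0r div1r subrr.
- exact/continuous_subspaceT/continuous_sinj.
- have cF : continuous F by move=> t; exact/differentiable_continuous/derivable1_diffP.
  split=> [t _||]; first by [].
  + by apply: cvg_at_right_filter; exact: cF.
  + by apply: cvg_at_left_filter; exact: cF.
- by move=> t _; rewrite derive1E derive_val.
Qed.

(** Expand the squared distance of [h] to its projection, integrated over [[0, d]]: the cross term
    is [- 2 b S], and the quadratic term is at most [b S] after enlarging [[0, d]] to a full
    period. *)
Lemma bessel (d : R) (h : R -> R) (s : seq int) :
  0 <= d -> d <= b^-1 -> continuous h -> uniq s ->
  \sum_(j <- s) ((\int[mu]_(t in `[0, d]) (h t * cosj j t)) ^+ 2
               + (\int[mu]_(t in `[0, d]) (h t * sinj j t)) ^+ 2)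
  <= b^-1 * \int[mu]_(t in `[0, d]) (h t ^+ 2).
Proof.
move=> d0 db ch us.
have cc := continuous_cosj; have cs := continuous_sinj.
set A := fun j => \int[mu]_(t in `[0, d]) (h t * cosj j t).
set B := fun j => \int[mu]_(t in `[0, d]) (h t * sinj j t).
set S := \sum_(j <- s) _.
have integ (x y : R) (f : R -> R) : continuous f ->
    mu.-integrable `[x, y] (EFin \o f) by exact: continuous_integrable_itv.
have cZ (k : R) (f : R -> R) : continuous f -> continuous (fun t => k * f t).
  by move=> cf; apply: continuous_mul => // t; exact: cvg_cst.
(* [b * p] is the real part of the orthogonal projection of [h] onto the span of the
   exponentials, and [b ^+ 2 * N] is the squared modulus of this projection. *)
pose p t := \sum_(j <- s) (A j * cosj j t + B j * sinj j t).
pose N t := \sum_(j <- s) \sum_(i <- s)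
  ((A j * A i + B j * B i) * cosj (j - i) t + (B j * A i - A j * B i) * sinj (j - i) t).
have cp : continuous p.
  by apply: continuous_sum => j t; apply: cvgD; apply: cZ.
have cN : continuous N.
  apply: continuous_sum => j; apply: continuous_sum => i t.
  by apply: cvgD; apply: cZ.
have NE t : N t = p t ^+ 2 + (\sum_(j <- s) (A j * sinj j t - B j * cosj j t)) ^+ 2.
  rewrite !expr2 /p !big_distrlr/= -big_split/=; apply: eq_bigr => j _.
  rewrite -big_split/=; apply: eq_bigr => i _.
  by rewrite cosjB sinjB; ring.
have intp : \int[mu]_(t in `[0, d]) (h t * p t) = S.
  under eq_Rintegral do rewrite mulr_sumr.
  rewrite Rintegral_sum//; last first.
    move=> j; apply: integ; apply: continuous_mul => // t.
    by apply: cvgD; apply: cZ.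
  apply: eq_bigr => j _.
  have -> : (fun t => h t * (A j * cosj j t + B j * sinj j t)) =
      (fun t => A j * (h t * cosj j t) + B j * (h t * sinj j t)).
    by apply/funext => t; ring.
  rewrite RintegralD//; last 2 first.
  - by apply: integ; apply: cZ; exact: continuous_mul.
  - by apply: integ; apply: cZ; exact: continuous_mul.
  by rewrite !RintegralZl//; apply: integ; exact: continuous_mul.
(* Orthogonality over the full period leaves only the diagonal terms [i = j]. *)
have intN : \int[mu]_(t in `[0, b^-1]) N t = b^-1 * S.
  rewrite Rintegral_sum//; last first.
    move=> j; apply: integ; apply: continuous_sum => i t.
    by apply: cvgD; apply: cZ.
  rewrite /S mulr_sumr; apply: eq_big_seq => j js.
  rewrite Rintegral_sum//; last by move=> i; apply: integ => t; apply: cvgD; apply: cZ.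
  rewrite (bigD1_seq j)//= big1_seq ?addr0.
    rewrite RintegralD//; [|exact/integ/cZ|exact/integ/cZ].
    rewrite !RintegralZl//; [|exact: integ|exact: integ].
    by rewrite subrr Rintegral_cosj// Rintegral_sinj// eqxx mulr1n mulr0 addr0 mulrC -!expr2.
  move=> i /andP[ij _].
  rewrite RintegralD//; [|exact/integ/cZ|exact/integ/cZ].
  rewrite !RintegralZl//; [|exact: integ|exact: integ].
  by rewrite Rintegral_cosj// Rintegral_sinj// subr_eq0 eq_sym (negbTE ij) mulr0n !mulr0 addr0.
have leN : \int[mu]_(t in `[0, d]) N t <= \int[mu]_(t in `[0, b^-1]) N t.
  rewrite /Rintegral fine_le//.
  - by apply: integrable_fin_num => //; exact: integ.
  - by apply: integrable_fin_num => //; exact: integ.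
  apply: ge0_subset_integral => //.
  - by have /integrableP[] := @integ 0 b^-1 _ cN.
  - by move=> t _; rewrite lee_fin NE addr_ge0 ?sqr_ge0.
  - by apply: subset_itvl; rewrite bnd_simp.
have ch2 : continuous (fun t => h t ^+ 2) by exact: continuous_mul.
have chp : continuous (fun t => h t * (b * p t)) by apply: continuous_mul => //; exact: cZ.
have chp2 : continuous (fun t => -2 * b * (h t * p t)) by apply/cZ/continuous_mul.
have cbN : continuous (fun t => b ^+ 2 * N t) by exact: cZ.
(* The integrand is the squared modulus of [h - b (p + i q)], with [q] the imaginary counterpart of
   [p]. *)
have : 0 <= \int[mu]_(t in `[0, d]) (h t ^+ 2 + (-2 * b * (h t * p t) + b ^+ 2 * N t)).
  apply: Rintegral_ge0 => t _; rewrite NE.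
  set q := \sum_(j <- s) _.
  rewrite (_ : _ + _ = (h t - b * p t) ^+ 2 + (b * q) ^+ 2); last by ring.
  by rewrite addr_ge0 ?sqr_ge0.
rewrite RintegralD//; [|exact: integ|]; last first.
  by apply: integ => t; apply: cvgD; [exact: chp2|exact: cbN].
rewrite RintegralD//; [|exact: integ|exact: integ].
rewrite !RintegralZl//; [|exact/integ/continuous_mul|exact: integ].
rewrite intp => H.
have {}leN : b ^+ 2 * \int[mu]_(t in `[0, d]) N t <= b * S.
  apply: (@le_trans _ _ (b ^+ 2 * (b^-1 * S))).
    by rewrite ler_wpM2l ?sqr_ge0// -intN.
  by rewrite mulrA expr2 mulfK// gt_eqF.
have {H leN} : b * S <= \int[mu]_(t in `[0, d]) (h t ^+ 2) by lra.
by rewrite mulrC -ler_pdivlMr// mulrC.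
Qed.
End Bessel.

(** * A necessary condition for the lower frame bound *)

Lemma esum_le_uniq (R : realType) (T : choiceType) (f : T -> R) (X : R) :
  (forall s : seq T, uniq s -> \sum_(x <- s) f x <= X) ->
  (\esum_(x in setT) (f x)%:E <= X%:E)%E.
Proof.
move=> H; apply: ge_ereal_sup => _ [A [finA _] <-].
by rewrite fsbig_finite//= sumEFin lee_fin; apply: H; exact: finmap.fset_uniq.
Qed.

Lemma continuous_tent (R : realType) : continuous (@tent R).
Proof.
move=> x; apply/cvgrPdist_lt => e e0; near=> y.
by apply: le_lt_trans (tent_lipschitz x y) _; near: y; exact: cvgr_dist_lt.
Unshelve. all: by end_near. Qed.

Section StepFunction.
Context {R : realType}.
Notation mu := (@lebesgue_measure R).
Variables (I : finType) (y : I -> R) (d : R).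
Hypothesis d0 : 0 <= d.

Let J i : set R := `[y i, y i + d].

Definition step (k : I -> R) (x : R) : R := \sum_i k i * \1_(J i) x.

Lemma measurable_step k : measurable_fun setT (step k).
Proof.
apply: measurable_sum => i; apply: measurable_funM; first exact: measurable_cst.
by apply: measurable_indic; exact: measurable_itv.
Qed.

Let step_mulE k G x : step k x * G x = \sum_i ((fun z => k i * G z) \_ (J i)) x.
Proof.
rewrite /step mulr_suml; apply: eq_bigr => i _.
by rewrite patchE indicE; case: ifP => _; rewrite ?mulr1// mulr0 mul0r.
Qed.

Let continuous_Z (k : R) (G : R -> R) : continuous G -> continuous (fun t => k * G t).
Proof. by move=> cG; apply: continuous_mul => // t; exact: cvg_cst. Qed.

Let integrable_piece (k : R) (G : R -> R) i : continuous G ->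
  mu.-integrable setT (EFin \o ((fun z => k * G z) \_ (J i))).
Proof.
move=> cG; rewrite -restrict_EFin.
apply: (iffLR (integrable_mkcond _ _)); first exact: measurable_itv.
by apply: continuous_integrable_itv; exact: continuous_Z.
Qed.

Lemma integrable_step_mul k (G : R -> R) : continuous G ->
  mu.-integrable setT (EFin \o (fun x => step k x * G x)).
Proof.
move=> cG.
have -> : EFin \o (fun x => step k x * G x) =
    (fun x => (\sum_i (EFin \o ((fun z => (k i * G z)%R) \_ (J i))) x)%E).
  by apply/funext => x /=; rewrite step_mulE sumEFin.
by apply: integrable_sum => // i _; exact: integrable_piece.
Qed.

Lemma Rintegral_step_mul k (G : R -> R) : continuous G ->
  \int[mu]_x (step k x * G x) =
  \sum_i k i * \int[mu]_(t in `[0, d]) G (t + y i).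
Proof.
move=> cG; under eq_Rintegral do rewrite step_mulE.
rewrite Rintegral_sum//; last by move=> i; exact: integrable_piece.
apply: eq_bigr => i _; rewrite -Rintegral_mkcond RintegralZl.
- by congr (_ * _); exact: Rintegral_translate.
- exact: measurable_itv.
- exact: continuous_integrable_itv.
Qed.

Hypothesis disjointJ : forall i j x, x \in J i -> x \in J j -> i = j.

Lemma step_sqr k x : step k x ^+ 2 = step (fun i => k i ^+ 2) x.
Proof.
rewrite expr2 /step big_distrlr/=; apply: eq_bigr => i _.
rewrite (bigD1 i)//= big1 ?addr0 => [|j ji].
  by rewrite indicE; case: (x \in J i); rewrite ?mulr1// !mulr0.
rewrite !indicE; have [xi|] := boolP (x \in J i); last by rewrite mulr0 mul0r.
have [xj|] := boolP (x \in J j); last by rewrite !mulr0.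
by rewrite (disjointJ xi xj) eqxx in ji.
Qed.

Lemma sqnorm_step k : sqnorm (step k, cst 0) = (d * \sum_i k i ^+ 2)%:E.
Proof.
have int1 := integrable_step_mul (fun i => k i ^+ 2) (@cst_continuous _ _ (1 : R)).
rewrite /sqnorm/=.
under eq_integral do rewrite expr0n/= addr0 step_sqr -[step _ _]mulr1.
rewrite -[LHS]fineK; last exact: integrable_fin_num.
congr EFin; rewrite [LHS](Rintegral_step_mul (fun i => k i ^+ 2) (@cst_continuous _ _ (1 : R))).
rewrite mulr_sumr; apply: eq_bigr => i _.
rewrite Rintegral_cst//= lebesgue_measure_itv/= lte_fin mul1r mulrC.
by case: ltgtP d0 => //= [_|<-] _; rewrite ?oppr0 ?addr0.
Qed.

Lemma inL2_step k : inL2 (step k, cst 0).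
Proof.
split; first exact: measurable_step.
by split; [exact: measurable_cst|rewrite sqnorm_step ltry].
Qed.

End StepFunction.

Section Criterion.
Context {R : realType}.
Notation mu := (@lebesgue_measure R).
Variables (a b A X : R) (I : finType) (c : I -> R) (n : I -> int).
Hypotheses (a0 : 0 < a) (b0 : 0 < b) (inj_n : injective n).
Hypothesis lower_bound : forall f : cfun R, inL2 f -> (A%:E * sqnorm f <=
  \esum_(lj in [set: int * int]) (inner_sqabs f (gabor (@Q2 R) a b lj))%:E)%E.
Hypothesis column_sum : forall s : seq int, uniq s ->
  \sum_(l <- s) (\sum_i c i * tent ((n i)%:~R / b - a * l%:~R)) ^+ 2 <= X.

Let y i := (n i)%:~R / b.
(** At [t = 0] this is the column sum controlled by [column_sum]; [t] is the offset inside the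
    intervals of the test function. *)
Let H (l : int) (t : R) := \sum_i c i * tent (t + y i - a * l%:~R).

Let continuous_tent_shift (z : R) : continuous (fun t => tent (t + z) : R).
Proof.
move=> t; apply: (@continuous_comp _ _ _ (fun t => t + z) tent).
  by apply: cvgD; [exact: cvg_id|exact: cvg_cst].
exact: continuous_tent.
Qed.

Let continuous_H l : continuous (H l).
Proof.
apply: continuous_sum => i; apply: continuous_mul => [t|]; first exact: cvg_cst.
under eq_fun do rewrite -addrA.
exact: continuous_tent_shift.
Qed.

Section Width.
Variable d : R.
Hypotheses (d0 : 0 < d) (db : d < b^-1).

Lemma disjoint_supports i j (x : R) : x \in `[y i, y i + d]%classic ->
  x \in `[y j, y j + d]%classic -> i = j.
Proof.
rewrite !inE/= !in_itv/= => /andP[h1 h2] /andP[h3 h4]; apply: inj_n.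
have : `|(n i - n j)%:~R / b| < b^-1.
  rewrite intrB mulrBl -/(y i) -/(y j) ltr_norml.
  by move: (y i) (y j) h1 h2 h3 h4 => p q h1 h2 h3 h4; move: db; lra.
rewrite normrM (gtr0_norm (_ : 0 < b^-1)) ?invr_gt0//.
rewrite gtr_pMl ?invr_gt0// -intr_norm ltrz1.
by move: (n i) (n j) => p q; clear; lia.
Qed.

Let f := (step y d c, cst 0) : cfun R.

(** The modulations are invariant under translation by [y i], an integer multiple of [b^-1]; moving
    every interval to [[0, d]] thus keeps them and collects the tents into [H l]. *)
Lemma inner_sqabs_gabor l j : inner_sqabs f (gabor (@Q2 R) a b (l, j)) =
  (\int[mu]_(t in `[0, d]) (H l t * cosj b j t)) ^+ 2 +
  (\int[mu]_(t in `[0, d]) (H l t * sinj b j t)) ^+ 2.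
Proof.
have step_trig (e : R -> R) : continuous e ->
    (forall i t, e (t + y i) = e t) ->
    \int[mu]_x (step y d c x * (e x * tent (x - a * l%:~R))) =
    \int[mu]_(t in `[0, d]) (H l t * e t).
  move=> ce eE; have ct := continuous_tent_shift.
  rewrite Rintegral_step_mul ?ltW//; last exact: continuous_mul.
  under [RHS]eq_Rintegral do rewrite /H mulr_suml.
  have cG i : continuous (fun t => e (t + y i) * tent (t + y i - a * l%:~R)).
    under eq_fun do rewrite eE -addrA.
    exact: continuous_mul.
  rewrite Rintegral_sum//; last first.
    move=> i; apply: continuous_integrable_itv.
    under eq_fun do rewrite -mulrA (mulrC (tent _)) -(eE i).
    by apply: continuous_mul => // t; exact: cvg_cst.
  apply: eq_bigr => i _; rewrite -RintegralZl//; last exact: continuous_integrable_itv.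
  by apply: eq_Rintegral => t _; rewrite eE mulrA mulrAC.
rewrite /inner_sqabs /inner_re /inner_im /=; congr (_ ^+ 2 + _).
  rewrite -step_trig; [|exact: continuous_cosj|by move=> i t; exact: cosj_translate].
  by apply: eq_Rintegral => x _; rewrite mulr0 subr0 mul0r addr0.
(* The conjugation in the inner product puts a minus sign on the sine integral, which the square
   absorbs. *)
rewrite -[RHS]sqrrN; congr (_ ^+ 2).
rewrite -step_trig; [|exact: continuous_sinj|by move=> i t; exact: sinj_translate].
rewrite -mulN1r -RintegralZl//; last first.
  apply: integrable_step_mul.
  by apply: continuous_mul; [exact: continuous_sinj|exact: continuous_tent_shift].
by apply: eq_Rintegral => x _; rewrite mul0r sub0r mulr0 addr0 mulN1r.
Qed.

End Width.

Let K := \sum_i `|c i|.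

Let K0 : 0 <= K. Proof. exact: sumr_ge0. Qed.

Let H_le l t : `|H l t| <= K.
Proof.
apply: le_trans (ler_norm_sum _ _ _) _; apply: ler_sum => i _.
by rewrite normrM ler_piMr// ger0_norm ?tent_ge0 ?tent_le1.
Qed.

Let H_lipschitz l t : 0 <= t -> `|H l t - H l 0| <= K * t.
Proof.
move=> t0; rewrite /H -sumrB mulr_suml.
apply: le_trans (ler_norm_sum _ _ _) _; apply: ler_sum => i _.
rewrite -mulrBr normrM ler_wpM2l//.
apply: le_trans (tent_lipschitz _ _) _.
have -> : t + y i - a * l%:~R - (0 + y i - a * l%:~R) = t by ring.
by rewrite ger0_norm.
Qed.

Let sqrH_le l t : 0 <= t -> H l t ^+ 2 <= H l 0 ^+ 2 + 2 * K ^+ 2 * t.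
Proof.
move=> t0; rewrite -lerBlDl subr_sqr (le_trans (ler_norm _))// normrM.
have -> : 2 * K ^+ 2 * t = (K * t) * (K + K) by ring.
apply: ler_pM => //; first exact: H_lipschitz.
by rewrite (le_trans (ler_normD _ _))// lerD.
Qed.

Let H_eq0 : exists L : nat, forall l t, L%:Z <= `|l| -> 0 <= t <= b^-1 -> H l t = 0.
Proof.
pose Y := \sum_i `|y i|.
(* Chosen so that [|a l| >= Y + b^-1 + 1], while [|t + y i| <= b^-1 + Y]: the tent is evaluated at
   distance at least [1] from [0]. *)
exists (Num.truncn ((Y + b^-1 + 1) / a)).+1 => l t lL /andP[t0 tb].
rewrite /H big1// => i _; rewrite tent_eq0 ?mulr0//.
have yY : `|y i| <= Y by rewrite /Y (bigD1 i)//= lerDl sumr_ge0.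
have al : Y + b^-1 + 1 <= `|a * l%:~R|.
  rewrite normrM (gtr0_norm a0) mulrC -ler_pdivrMr// ltW//.
  apply: lt_le_trans (truncnS_gt _) _.
  by rewrite -intr_norm -[_%:R]/((Posz _)%:~R) ler_int.
have := lerB_dist (a * l%:~R) (t + y i); rewrite distrC.
have : `|t + y i| <= b^-1 + Y by rewrite (le_trans (ler_normD _ _))// lerD// ger0_norm.
lra.
Qed.

(** Bessel's inequality for each [l] bounds the frame sum by integrals of [H l ^+ 2] over [[0, d]].
    Only finitely many [l] matter, and on each [H l ^+ 2] exceeds its value at [0] by [O(d)];
    dividing by [d] gives the claim. *)
Let width_bound : exists Z : R, 0 <= Z /\ forall d, 0 < d -> d < b^-1 ->
  A * \sum_i c i ^+ 2 <= X / b + Z * d.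
Proof.
have [L HL] := H_eq0.
pose W : seq int := [seq i%:Z - L%:Z | i <- iota 0 (2 * L)].
have uW : uniq W by rewrite map_inj_uniq ?iota_uniq// => i j; lia.
have HW l t : l \notin W -> 0 <= t <= b^-1 -> H l t = 0.
  move=> lW; apply: HL; rewrite leNgt; apply: contra lW => lL; apply/mapP.
  by exists `|(l + L%:Z)%R|%N; rewrite ?mem_iota; lia.
exists ((size W)%:R * (2 * K ^+ 2) / b); split.
  by rewrite divr_ge0 ?(ltW b0)// !mulr_ge0// sqr_ge0.
move=> d d0 db.
pose Hint l := \int[mu]_(t in `[0, d]) (H l t ^+ 2).
have cH2 l : continuous (fun t => H l t ^+ 2).
  by apply: continuous_mul; exact: continuous_H.
have Hint_ge0 l : 0 <= Hint l by apply: Rintegral_ge0 => t _; exact: sqr_ge0.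
have Hint_le l : Hint l <= d * (H l 0 ^+ 2 + 2 * K ^+ 2 * d).
  have -> : d * (H l 0 ^+ 2 + 2 * K ^+ 2 * d) =
      \int[mu]_(t in `[0, d]) (H l 0 ^+ 2 + 2 * K ^+ 2 * d).
    by rewrite Rintegral_cst//= lebesgue_measure_itv/= lte_fin d0 /= oppr0 addr0 mulrC.
  apply: le_Rintegral => //.
  - exact: continuous_integrable_itv.
  - by apply: continuous_integrable_itv => t; exact: cvg_cst.
  - move=> t /=; rewrite in_itv/= => /andP[t0 td].
    apply: le_trans (sqrH_le l t0) _; rewrite lerD2l ler_wpM2l//.
    by rewrite mulr_ge0// sqr_ge0.
have sumHint (s : seq int) : uniq s -> \sum_(l <- s) Hint l <= \sum_(l <- W) Hint l.
  move=> us; apply: ler_sum_uniq_support => // l _ lW.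
  rewrite /Hint (@eq_Rintegral _ _ _ _ _ (cst 0)); first by rewrite Rintegral_cst// mul0r.
  move=> t; rewrite inE/= in_itv/= => /andP[t0 td].
  by rewrite HW ?expr0n//= t0 (le_trans td)// ltW.
pose f : cfun R := (step y d c, cst 0).
have esum_le : (\esum_(lj in [set: int * int])
    (inner_sqabs f (gabor (@Q2 R) a b lj))%:E <= (b^-1 * \sum_(l <- W) Hint l)%:E)%E.
  apply: esum_le_uniq => s us.
  (* A finite set of pairs is enlarged to a grid, so that Bessel's inequality applies to each [l]
     separately. *)
  pose s1 := undup [seq x.1 | x <- s]; pose s2 := undup [seq x.2 | x <- s].
  apply: (@le_trans _ _ (\sum_(x <- [seq (l, j) | l <- s1, j <- s2])
      inner_sqabs f (gabor (@Q2 R) a b x))).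
    apply: ler_sum_uniq_support => //.
    - by apply: allpairs_uniq; rewrite ?undup_uniq// => -[? ?] [? ?].
    - by move=> x; rewrite addr_ge0 ?sqr_ge0.
    - move=> [l j] ljs; case/negP; apply/allpairsP; exists (l, j).
      by rewrite !mem_undup; split=> //; [apply: (map_f fst ljs)|apply: (map_f snd ljs)].
  rewrite big_allpairs_dep/=.
  apply: (@le_trans _ _ (b^-1 * \sum_(l <- s1) Hint l)); last first.
    by rewrite ler_wpM2l ?invr_ge0 ?(ltW b0)// sumHint// undup_uniq.
  rewrite mulr_sumr; apply: ler_sum => l _.
  under eq_bigr do rewrite (inner_sqabs_gabor d0).
  by apply: bessel; rewrite ?undup_uniq// ltW.
have := le_trans (lower_bound (inL2_step (ltW d0) (disjoint_supports db) c)) esum_le.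
rewrite sqnorm_step ?(ltW d0)//; last exact: disjoint_supports db.
rewrite -EFinM lee_fin => ineq.
rewrite -(ler_pM2l d0); apply: (@le_trans _ _ (b^-1 * \sum_(l <- W) Hint l)).
  by move: ineq; rewrite mulrCA.
apply: (@le_trans _ _ (b^-1 * \sum_(l <- W) d * (H l 0 ^+ 2 + 2 * K ^+ 2 * d))).
  by rewrite ler_wpM2l ?invr_ge0 ?(ltW b0)// ler_sum.
have -> : \sum_(l <- W) d * (H l 0 ^+ 2 + 2 * K ^+ 2 * d) =
    d * (\sum_(l <- W) H l 0 ^+ 2 + (size W)%:R * (2 * K ^+ 2) * d).
  rewrite -mulr_sumr big_split/= big_const_seq count_predT iter_addr_0 -mulr_natl.
  by ring.
have := column_sum uW; under eq_bigr do under eq_bigr do rewrite -[_ / b]add0r.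
rewrite -/(H _ 0) => colW.
have -> : d * (X / b + (size W)%:R * (2 * K ^+ 2) / b * d) =
  b^-1 * (d * (X + (size W)%:R * (2 * K ^+ 2) * d)) by ring.
by rewrite ler_wpM2l ?invr_ge0 ?(ltW b0)// ler_wpM2l ?(ltW d0)// lerD2r.
Qed.

Lemma gabor_lower_bound : A * \sum_i c i ^+ 2 <= X / b.
Proof.
have [Z [Z0 ZP]] := width_bound; apply/ler_addgt0Pr => e e0.
(* The first bound ensures [d < b^-1], the second [Z d <= e]; adding [1] avoids division by zero. *)
pose d := Num.min (b^-1 / 2) (e / (Z + 1)).
have Z1 : 0 < Z + 1 by lra.
have bV : 0 < b^-1 by rewrite invr_gt0.
have d0 : 0 < d by rewrite lt_min !divr_gt0.
have db : d < b^-1 by rewrite gt_min; apply/orP; left; lra.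
apply: le_trans (ZP d d0 db) _; rewrite lerD2l.
have : d <= e / (Z + 1) by rewrite ge_min lexx orbT.
by rewrite ler_pdivlMr//; nra.
Qed.

End Criterion.

(** * The two families of parameters *)

(** Truncating the periodic sequence to [N] periods gives coefficients of squared norm [2 N V],
    while the column sums stay bounded by [C]; the lower bound would force [A * 2 N V <= C / b] for
    every [N]. *)
Lemma gabor_tent_not_frame (R : realType) (k m M : nat) (a b P : R) (G : {set 'I_k}) :
  0 < a -> 0 < b -> 1 < P -> P = (2 * k + 1)%:R / b -> P / 2 = M%:R * a ->
  (M <= 2 * m + 1)%N -> (m < #|G|)%N ->
  (forall r, r \in G -> forall l : int,
     `|P / 2 - 1| <= `|r.+1%:R / b - a * l%:~R|) ->
  ~ is_frame (gabor (@Q2 R) a b).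
Proof.
move=> a0 b0 P1 PE PM Mm mG good [A [B [A0 [_ frame]]]].
pose x (r : 'I_k) : R := r.+1%:R / b.
have xP r : 0 < x r < P / 2.
  rewrite divr_gt0//= PE -mulrA (mulrC b^-1) mulrA ltr_pM2r ?invr_gt0//.
  rewrite ltr_pdivlMr// -natrM ltr_nat; have := ltn_ord r; lia.
have [v [[r0 vr0] [C CP]]] := exists_bounded_partial_sums P1 PM a0 Mm xP good mG.
pose V := \sum_r v r ^+ 2.
have V0 : 0 < V.
  rewrite /V (bigD1 r0)//= ltr_pwDl ?sumr_ge0// => [|r _]; last exact: sqr_ge0.
  by rewrite lt_def sqrf_eq0 vr0 sqr_ge0.
suff main N : A * (N%:R * (2 * V)) <= C / b.
  have AV : 0 < A * (2 * V) by rewrite !mulr_gt0.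
  have := main (Num.truncn (C / b / (A * (2 * V)))).+1.
  rewrite leNgt mulrCA -ltr_pdivrMr//; apply/negP/negPn.
  exact: truncnS_gt.
(* The triple [(j, r, e)] encodes the integer [j (2k+1) + r.+1] or [j (2k+1) - r.+1], with opposite
   coefficients. Since [1 <= r.+1 <= k], these residues modulo [2k+1] are distinct, so [n] is
   injective. *)
pose c (i : 'I_N * 'I_k * bool) := if i.2 then v i.1.2 else - v i.1.2.
pose n (i : 'I_N * 'I_k * bool) : int :=
  (i.1.1 * (2 * k + 1))%:Z + (if i.2 then i.1.2.+1%:Z else - i.1.2.+1%:Z).
have inj_n : injective n.
  move=> [[j r] e] [[j' r'] e']; rewrite /n/= => E.
  have [rk rk'] := (ltn_ord r, ltn_ord r').
  have jj' : j = j' :> nat.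
    move: E rk rk'; move: (nat_of_ord j) (nat_of_ord j') (nat_of_ord r) (nat_of_ord r').
    by case: e; case: e'; clear; nia.
  have [rr' ee'] : r = r' :> nat /\ e = e'.
    by move: E; rewrite jj'; case: e; case: e'; clear; lia.
  by congr (_, _, _) => //; apply/val_inj.
have sumI (F : 'I_N * 'I_k * bool -> R) : \sum_i F i =
    \sum_(j < N) \sum_(r < k) (F (j, r, true) + F (j, r, false)).
  transitivity (\sum_(p : 'I_N * 'I_k) \sum_(e : bool) F (p, e)).
    by rewrite pair_bigA; apply: eq_bigr => -[].
  by rewrite [RHS]pair_bigA; apply: eq_bigr => -[j r] _; rewrite big_bool.
have col (s : seq int) : uniq s ->
    \sum_(l <- s) (\sum_i c i * tent ((n i)%:~R / b - a * l%:~R)) ^+ 2 <= C.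
  move=> us; apply: le_trans (CP N s us); rewrite le_eqVlt; apply/orP; left; apply/eqP.
  apply: eq_bigr => l _; congr (_ ^+ 2); rewrite sumI; apply: eq_bigr => j _.
  apply: eq_bigr => r _; rewrite /c /n/= mulrBr mulNr.
  have E : (j * (2 * k + 1))%:Z%:~R / b = j%:R * P :> R.
    by rewrite PoszM intrM PE mulrA.
  by rewrite !intrD intrN !mulrDl E mulNr.
have := gabor_lower_bound a0 b0 inj_n (fun f fL2 => (frame f fL2).1) col.
suff -> : \sum_i c i ^+ 2 = N%:R * (2 * V) by [].
rewrite sumI (eq_bigr (fun=> 2 * V)) => [|j _].
  by rewrite sumr_const card_ord [RHS]mulr_natl.
by rewrite /V mulr_sumr; apply: eq_bigr => r _; rewrite /c/=; ring.
Qed.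

Theorem theorem1p3 :
  (* (i) *)
  (forall k m : nat, (m < k)%N ->
     let a0 : Rdefinitions.R := 1 / (2 * m%:R + 1) in
     let b0 : Rdefinitions.R := (2 * k%:R + 1) / 2 in
     a0 * b0 < 1 ->
     forall a b : Rdefinitions.R, 0 < a -> 0 < b ->
       a * b = (2 * k%:R + 1) / (2 * (2 * m%:R + 1)) ->
       b0 - a0 * (k%:R - m%:R) / 2 <= b <= b0 + a0 * (k%:R - m%:R) / 2 ->
       ~ is_frame (gabor (@Q2 Rdefinitions.R) a b)) /\
  (* (ii) *)
  (forall k m : nat, (0 < m)%N -> (m < k)%N ->
     let a : Rdefinitions.R := 1 / (2 * m%:R) in
     let b : Rdefinitions.R := (2 * k%:R + 1) / 2 in
     a * b < 1 -> coprime (4 * m) (2 * k + 1) ->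
     ~ is_frame (gabor (@Q2 Rdefinitions.R) a b)).
Proof.
split=> [k m mk a0 b0 _ a b apos bpos abE /andP[b_ge b_le]|k m m0 mk a b _ _].
  pose q : Rdefinitions.R := 2 * (2 * m%:R + 1).
  pose p : Rdefinitions.R := 2 * k%:R + 1.
  have m_ge0 : 0 <= m%:R :> Rdefinitions.R := ler0n _ _.
  have mkR : m%:R + 1 <= k%:R :> Rdefinitions.R by rewrite -[1]/(1%:R) -natrD ler_nat addn1.
  have q0 : 0 < q by rewrite /q; lra.
  have p0 : 0 < p by rewrite /p; lra.
  have a0E : a0 = 2 / q by rewrite /a0 /q; field; lra.
  have b_neq0 : b != 0 by rewrite gt_eqF.
  have q_neq0 : q != 0 by rewrite gt_eqF.
  have aE : a = p / q / b by rewrite -[a](mulfK b_neq0) abE.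
  have pE : (2 * k + 1)%:R = p by rewrite natrD natrM.
  have qE : (2 * (2 * m + 1))%:R = q by rewrite natrM natrD natrM.
  have bb0 : `|b0 - b| <= (k%:R - m%:R) / q.
    have -> : (k%:R - m%:R) / q = a0 * (k%:R - m%:R) / 2 by rewrite a0E; field.
    by rewrite ler_norml; move: b_ge b_le; set z := a0 * _ / 2; lra.
  pose B := [set r : 'I_k | `[< exists l : int,
    `|(2 * (2 * m + 1) * r.+1)%:Z - (2 * k + 1)%:Z * l| < (k - m)%:Z >] ]%SET.
  apply: (@gabor_tent_not_frame _ k m (2 * m + 1) a b (p / b) (~: B)) => //.
  (* Since [q >= 2], [b <= p / 2 + (k - m) / 2 < p]. *)
  - rewrite ltr_pdivlMr// mul1r.
    have : (k%:R - m%:R) / q <= (k%:R - m%:R) / 2.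
      by apply: ler_wpM2l; rewrite ?lef_pV2 ?posrE// /q; lra.
    by move: bb0; rewrite ler_norml /b0 -/p; move: (_ / q) => z; rewrite /p; lra.
  - by rewrite pE.
  - by rewrite aE natrD natrM /q; field; rewrite b_neq0/=; lra.
  - have Bk : (#|B| < k - m)%N := card_near_multiple mk.
    by have := cardsC B; rewrite card_ord; move: #|_| #|_| Bk => x y; clear -mk; lia.
  (* After clearing denominators the window has half-width [|b0 - b| / b <= (k - m) / (q b)], and
     the shift is [(q n - p l) / (q b)] with [n = r.+1]; an integer comparison of [|q n - p l|] with
     [k - m] decides. *)
  - move=> r; rewrite !inE => /asboolPn nB l.
    have le_int : (k - m)%:Z <= `|(2 * (2 * m + 1) * r.+1)%:Z - (2 * k + 1)%:Z * l|.
      by rewrite leNgt; apply/negP => lt_km; apply: nB; exists l.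
    have {le_int} le_real : k%:R - m%:R <= `|q * r.+1%:R - p * l%:~R|.
      move: le_int; rewrite -(ler_int Rdefinitions.R) intr_norm intrB !intrM.
      rewrite -[(k - m)%:Z%:~R]/((k - m)%:R) natrB 1?ltnW//.
      by rewrite -[(_ * _)%:Z%:~R]/((2 * (2 * m + 1) * r.+1)%:R) natrM qE -pE.
    have -> : p / b / 2 - 1 = (b0 - b) / b by rewrite /b0 -/p; field.
    have -> : r.+1%:R / b - a * l%:~R = (q * r.+1%:R - p * l%:~R) / q / b.
      by rewrite aE; field; rewrite b_neq0.
    rewrite normrM [leRHS]normrM ler_wpM2r// (le_trans bb0)//.
    by rewrite normrM (gtr0_norm (_ : 0 < q^-1)) ?invr_gt0// ler_wpM2r// invr_ge0 ltW.
have bpos : 0 < b by rewrite divr_gt0// addr_gt0// mulr_gt0// ltr0n; lia.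
have mpos : 0 < m%:R :> Rdefinitions.R by rewrite ltr0n.
(* In case (ii), [P = (2k+1) / b = 2] and [P / 2 = 1 = 2 m a]; the windows have half-width [0], so
   all [k] indices are admissible. *)
apply: (@gabor_tent_not_frame _ k m (2 * m) a b 2 [set: 'I_k]%SET) => //.
- by rewrite divr_gt0// mulr_gt0.
- by rewrite ltr1n.
- rewrite /b natrD natrM; field.
  by have := ler0n Rdefinitions.R k; lra.
- by rewrite divff// /a natrM; field; rewrite gt_eqF.
- by lia.
- by rewrite cardsT card_ord.
- by move=> r _ l; rewrite divff// subrr normr0.
Qed.
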